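(* For any $q$ (an indeterminate, or a complex number with $|q|>1$), the following identity of formal power series in $u$ holds: $$\frac{\prod_{i\ge1}(1+u/q^i)^2}{\prod_{i\ge1}(1-u^2/q^i)}=\sum_{n\ge0}u^n q^{\binom n2}\sum_{r=0}^{n}\frac{1}{\gamma_r\gamma_{n-r}}.$$
   Context: For $j\ge1$, $\gamma_j=q^{\binom{j}{2}}(q^j-1)(q^{j-1}-1)\cdots(q-1)=q^{j^2}(1-1/q)\cdots(1-1/q^j)$, and $\gamma_0=1$. When $q$ is an indeterminate, coefficients of powers of $u$ are taken in the field $\mathbb{Q}((q^{-1}))$ of formal Laurent series in $q^{-1}$; when $q$ is a complex number with $|q|>1$, the coefficients are convergent complex series. *)

(* Defs.v *)
From HB Require Import structures.
From mathcomp Require Import all_boot all_order all_algebra.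
From mathcomp Require Import zify.
From mathcomp Require Import complex.
From mathcomp Require Import boolp classical_sets functions fsbigop reals.
From mathcomp Require Import topology normedtype.

Set Implicit Arguments.
Unset Strict Implicit.
Unset Printing Implicit Defensive.

Import Order.TTheory GRing.Theory Num.Theory.
Import numFieldNormedType.Exports.
Local Open Scope classical_set_scope.
Local Open Scope ring_scope.

Record fps (R : Type) := Fps { fps_coef :> nat -> R }.

Lemma fpsP (R : Type) (f g : fps R) : (forall n, f n = g n) <-> f = g.
Proof.
split=> [|->//]; case: f g => [f] [g] /= fg.
by congr Fps; apply/funext.
Qed.

HB.instance Definition _ (R : Type) := gen_eqMixin (fps R).
HB.instance Definition _ (R : Type) := gen_choiceMixin (fps R).

Section FpsRing.
Variable R : comNzRingType.
Implicit Types (f g h : fps R).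

Definition fps_zero : fps R := Fps (fun=> 0).
Definition fps_opp f : fps R := Fps (fun n => - f n).
Definition fps_add f g : fps R := Fps (fun n => f n + g n).
Definition fps_one : fps R := Fps (fun n => (n == 0)%:R).
Definition fps_mul f g : fps R :=
  Fps (fun n => \sum_(i < n.+1) f i * g (n - i)%N).
Definition fps_scale (a : R) f : fps R := Fps (fun n => a * f n).

Fact fps_addA : associative fps_add.
Proof. by move=> f g h; apply/fpsP => n /=; rewrite addrA. Qed.

Fact fps_addC : commutative fps_add.
Proof. by move=> f g; apply/fpsP => n /=; rewrite addrC. Qed.

Fact fps_add0 : left_id fps_zero fps_add.
Proof. by move=> f; apply/fpsP => n /=; rewrite add0r. Qed.

Fact fps_addN : left_inverse fps_zero fps_opp fps_add.
Proof. by move=> f; apply/fpsP => n /=; rewrite addNr. Qed.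

HB.instance Definition _ :=
  GRing.isZmodule.Build (fps R) fps_addA fps_addC fps_add0 fps_addN.

Let trunc N f : {poly R} := \poly_(i < N) f i.

Let fps_mul_trunc N f g n : (n < N)%N ->
  fps_mul f g n = (trunc N f * trunc N g)`_n.
Proof.
move=> nN; rewrite coefM /=; apply: eq_bigr => i _; rewrite !coef_poly.
by rewrite !ifT //; have := ltn_ord i; lia.
Qed.

Let coefM_eq (p p' r r' : {poly R}) n :
  (forall i, (i <= n)%N -> p`_i = p'`_i) ->
  (forall i, (i <= n)%N -> r`_i = r'`_i) -> (p * r)`_n = (p' * r')`_n.
Proof.
move=> pp' rr'; rewrite !coefM; apply: eq_bigr => i _.
by rewrite pp' ?rr' ?leq_subr// -ltnS.
Qed.

Let trunc_mul N f g i : (i < N)%N ->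
  (trunc N (fps_mul f g))`_i = (trunc N f * trunc N g)`_i.
Proof. by move=> iN; rewrite coef_poly iN -fps_mul_trunc. Qed.

Fact fps_mulA : associative fps_mul.
Proof.
move=> f g h; apply/fpsP => n; rewrite !(@fps_mul_trunc n.+1)//.
transitivity ((trunc n.+1 f * (trunc n.+1 g * trunc n.+1 h))`_n).
  by apply: coefM_eq => // i i_n; apply: trunc_mul.
by rewrite mulrA; apply: coefM_eq => // i i_n; apply/esym/trunc_mul.
Qed.

Fact fps_mulC : commutative fps_mul.
Proof.
by move=> f g; apply/fpsP => n; rewrite !(@fps_mul_trunc n.+1)// mulrC.
Qed.

Fact fps_mul1 : left_id fps_one fps_mul.
Proof.
move=> f; apply/fpsP => n /=.
rewrite big_ord_recl /= mul1r subn0 big1 ?addr0// => i _.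
by rewrite mul0r.
Qed.

Fact fps_mulDl : left_distributive fps_mul fps_add.
Proof.
move=> f g h; apply/fpsP => n /=; rewrite -big_split /=.
by apply: eq_bigr => i _; rewrite mulrDl.
Qed.

Fact fps_oner_neq0 : fps_one != 0.
Proof. by apply/eqP => /fpsP /(_ 0%N) /= /eqP; rewrite oner_eq0. Qed.

HB.instance Definition _ := GRing.Zmodule_isComNzRing.Build (fps R)
  fps_mulA fps_mulC fps_mul1 fps_mulDl fps_oner_neq0.

Fact fps_scaleA a b f : fps_scale a (fps_scale b f) = fps_scale (a * b) f.
Proof. by apply/fpsP => n /=; rewrite mulrA. Qed.

Fact fps_scale1 : left_id 1 fps_scale.
Proof. by move=> f; apply/fpsP => n /=; rewrite mul1r. Qed.

Fact fps_scaleDr : right_distributive fps_scale +%R.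
Proof. by move=> a f g; apply/fpsP => n /=; rewrite mulrDr. Qed.

Fact fps_scaleDl f : {morph fps_scale^~ f : a b / a + b}.
Proof. by move=> a b; apply/fpsP => n /=; rewrite mulrDl. Qed.

HB.instance Definition _ := GRing.Zmodule_isLmodule.Build R (fps R)
  fps_scaleA fps_scale1 fps_scaleDr fps_scaleDl.

Fact fps_scaleAl (a : R) f g : a *: (f * g) = (a *: f) * g.
Proof.
by apply/fpsP => n /=; rewrite mulr_sumr; apply: eq_bigr => i _; rewrite mulrA.
Qed.

HB.instance Definition _ :=
  GRing.Lmodule_isLalgebra.Build R (fps R) fps_scaleAl.
HB.instance Definition _ := GRing.Lalgebra_isComAlgebra.Build R (fps R).

Definition fpsX : fps R := Fps (fun n => (n == 1)%:R).

Lemma fps_coefM f g n : (f * g) n = \sum_(i < n.+1) f i * g (n - i)%N.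
Proof. by []. Qed.

End FpsRing.

Arguments fpsX {R}.

Section FpsUnit.
Variable R : comUnitRingType.
Implicit Types (f g : fps R).

(* The first n coefficients of the inverse, by g_0 = f_0^-1 and               *)
(* g_n = - f_0^-1 * \sum_(i < n) f_(n-i) g_i.                                 *)
Fixpoint fps_inv_seq f n : seq R :=
  if n is m.+1 then
    let s := fps_inv_seq f m in
    rcons s ((f 0%N)^-1 *
             ((m == 0)%:R - \sum_(i < m) f (m - i)%N * s`_i))
  else [::].

Definition fps_unit : {pred fps R} := [pred f : fps R | f 0%N \is a GRing.unit].
Definition fps_inv f : fps R :=
  if f \in fps_unit then Fps (fun n => (fps_inv_seq f n.+1)`_n) else f.

Let size_inv_seq f n : size (fps_inv_seq f n) = n.
Proof. by elim: n => //= n IHn; rewrite size_rcons IHn. Qed.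

Let nth_inv_seq f n i : (i < n)%N ->
  (fps_inv_seq f n)`_i = (fps_inv_seq f i.+1)`_i.
Proof.
elim: n => // n IHn; rewrite ltnS leq_eqVlt => /orP[/eqP->//|lt_in].
by rewrite [in LHS]/= nth_rcons size_inv_seq lt_in IHn.
Qed.

Let inv_seqE f n : (fps_inv_seq f n.+1)`_n =
  (f 0%N)^-1 *
  ((n == 0)%:R - \sum_(i < n) f (n - i)%N * (fps_inv_seq f i.+1)`_i).
Proof.
rewrite [fps_inv_seq f n.+1]/= nth_rcons size_inv_seq ltnn eqxx.
congr (_ * (_ - _)); apply: eq_bigr => i _.
by congr (_ * _); apply: nth_inv_seq.
Qed.

Fact fps_mulV : {in fps_unit, left_inverse 1 fps_inv *%R}.
Proof.
move=> f Uf; have Uf0 : f 0%N \is a GRing.unit by [].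
apply/fpsP => n; rewrite fps_coefM big_ord_recr subnn.
have -> k : fps_inv f k = (fps_inv_seq f k.+1)`_k by rewrite /fps_inv Uf.
rewrite inv_seqE mulrC mulrA divrr// mul1r /= [LHS]addrC.
rewrite -[RHS](subrK (\sum_(i < n) f (n - i)%N * (fps_inv_seq f i.+1)`_i)).
by congr (_ + _); apply: eq_bigr => i _; rewrite mulrC /fps_inv Uf.
Qed.

Fact fps_unitPl f g : g * f = 1 -> fps_unit f.
Proof.
move=> /fpsP /(_ 0%N); rewrite fps_coefM big_ord1 /= => gf1.
by apply/unitrPr; exists (g 0%N); rewrite mulrC.
Qed.

Fact fps_inv_out : {in [predC fps_unit], fps_inv =1 id}.
Proof. by move=> f /negbTE Uf; rewrite /fps_inv Uf. Qed.

HB.instance Definition _ := GRing.ComNzRing_hasMulInverse.Build (fps R)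
  fps_mulV fps_unitPl fps_inv_out.

Lemma fps_unitE f : (f \is a GRing.unit) = (f 0%N \is a GRing.unit).
Proof. by []. Qed.

End FpsUnit.

(* Infinite products of power series are taken coefficientwise:               *)
(* \prod_(i >= 1) F i = P when, for every n, the coefficients of degree n of  *)
(* the partial products \prod_(1 <= i < N.+1) F i converge to P n.            *)
(* There is no joint topological field structure in the hierarchy to cover    *)
(* both the complex numbers and Laurent series, so that the mode of           *)
(* convergence [cvg_to] of sequences of coefficients is a parameter.          *)
Definition is_fps_prod (R : comNzRingType) (cvg_to : (nat -> R) -> R -> Prop)
    (F : nat -> fps R) (P : fps R) : Prop :=
  forall n : nat, cvg_to (fun N => (\prod_(1 <= i < N.+1) F i) n) (P n).

Record laurent (F : nmodType) := Laurent {
  laurent_coef :> int -> F;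
  laurent_bounded : exists m : int, forall n, n < m -> laurent_coef n = 0 }.

Lemma laurentP (F : nmodType) (f g : laurent F) :
  (forall n, f n = g n) <-> f = g.
Proof.
split=> [|->//]; case: f g => [f bf] [g bg] /= /funext fg.
by case: g / fg bg => bg; congr Laurent; apply: Prop_irrelevance.
Qed.

HB.instance Definition _ (F : nmodType) := gen_eqMixin (laurent F).
HB.instance Definition _ (F : nmodType) := gen_choiceMixin (laurent F).

Section LaurentField.
Variable F : fieldType.
Implicit Types (f g h : laurent F) (A B : fps F) (m n : int).

Fact laurent_zero_bounded :
  exists m, forall n, n < m -> (fun=> 0 : F) n = 0.
Proof. by exists 0. Qed.
Definition laurent_zero := Laurent laurent_zero_bounded.

Fact laurent_opp_bounded f :
  exists m, forall n, n < m -> - f n = 0.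
Proof.
case: (laurent_bounded f) => m fm; exists m => n /fm ->; exact: oppr0.
Qed.
Definition laurent_opp f := Laurent (laurent_opp_bounded f).

Fact laurent_add_bounded f g :
  exists m, forall n, n < m -> f n + g n = 0.
Proof.
case: (laurent_bounded f) (laurent_bounded g) => [m fm] [k gk].
exists (Num.min m k) => n; rewrite lt_min => /andP[/fm -> /gk ->].
exact: addr0.
Qed.
Definition laurent_add f g := Laurent (laurent_add_bounded f g).

Fact laurent_monomial_bounded k :
  exists m, forall n, n < m -> (n == k)%:R = 0 :> F.
Proof. by exists k => n nk; rewrite lt_eqF. Qed.
Definition laurent_monomial k := Laurent (laurent_monomial_bounded k).

(* The sum, over a set of indices, is a finite one, since only finitely many  *)
(* of its terms are nonzero.                                                  *)
Definition laurent_conv f g n : F := \sum_(i \in [set: int]) f i * g (n - i).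

Fact laurent_mul_bounded f g :
  exists m, forall n, n < m -> laurent_conv f g n = 0.
Proof.
case: (laurent_bounded f) (laurent_bounded g) => [m fm] [k gk].
exists (m + k) => n nmk; apply: fsbig1 => i _.
have [/fm ->|mi] := ltP i m; first by rewrite mul0r.
by rewrite gk ?mulr0//; lia.
Qed.
Definition laurent_mul f g := Laurent (laurent_mul_bounded f g).

Fact laurent_addA : associative laurent_add.
Proof. by move=> f g h; apply/laurentP => n /=; rewrite addrA. Qed.

Fact laurent_addC : commutative laurent_add.
Proof. by move=> f g; apply/laurentP => n /=; rewrite addrC. Qed.

Fact laurent_add0 : left_id laurent_zero laurent_add.
Proof. by move=> f; apply/laurentP => n /=; rewrite add0r. Qed.

Fact laurent_addN : left_inverse laurent_zero laurent_opp laurent_add.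
Proof. by move=> f; apply/laurentP => n /=; rewrite addNr. Qed.

HB.instance Definition _ := GRing.isZmodule.Build (laurent F)
  laurent_addA laurent_addC laurent_add0 laurent_addN.

(* The ring axioms are transferred from power series: [laurent_of m A] is     *)
(* t^m A(t).                                                                  *)
Let at_int A n : F := if n is Posz k then A k else 0.

Fact laurent_of_bounded m A :
  exists k, forall n, n < k -> at_int A (n - m) = 0.
Proof. by exists m => n nm; case E : (n - m) => [k|k] //=; lia. Qed.
Definition laurent_of m A := Laurent (laurent_of_bounded m A).

Lemma laurent_ofP f : exists m A, f = laurent_of m A.
Proof.
case: (laurent_bounded f) => m fm.
exists m, (Fps (fun k => f (m + k%:Z))); apply/laurentP => n /=.
case E : (n - m) => [k|k] /=; first by congr (f _); lia.
by apply: fm; lia.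
Qed.

Lemma laurent_ofP2 f g :
  exists m A B, f = laurent_of m A /\ g = laurent_of m B.
Proof.
case: (laurent_bounded f) (laurent_bounded g) => [m fm] [k gk].
pose l := Num.min m k.
exists l, (Fps (fun i => f (l + i%:Z))), (Fps (fun i => g (l + i%:Z))).
by split; apply/laurentP => n /=;
  (case E : (n - l) => [i|i] /=; [congr (_ _); lia|]);
  [apply: fm|apply: gk]; rewrite /l in E; lia.
Qed.

Lemma laurent_ofD m A B :
  laurent_of m A + laurent_of m B = laurent_of m (A + B).
Proof. by apply/laurentP => n /=; case: (n - m) => //= _; rewrite addr0. Qed.

Lemma laurent_ofM m k A B :
  laurent_mul (laurent_of m A) (laurent_of k B) = laurent_of (m + k) (A * B).
Proof.
apply/laurentP => n /=; rewrite /laurent_conv /=.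
case E : (n - (m + k)) => [N|N] /=; last first.
  apply: fsbig1 => i _; case Ei : (i - m) => [j|j] /=; rewrite ?mul0r//.
  by case Ej : (n - i - k) => [l|l] /=; rewrite ?mulr0//; lia.
rewrite (fsbigE [seq m + i%:Z | i <- iota 0 N.+1])//; last 2 first.
- by rewrite map_inj_uniq ?iota_uniq// => i j /addrI [].
- move=> i _ iN; case Ei : (i - m) => [j|j] /=; rewrite ?mul0r//.
  case Ej : (n - i - k) => [l|l] /=; rewrite ?mulr0//.
  case/mapP: iN; exists j; last by lia.
  by rewrite mem_iota; lia.
under eq_bigl do rewrite in_setT.
rewrite big_map -[iota 0 _]/(index_iota 0 N.+1) big_mkord.
apply: eq_bigr => i _; have iN := ltn_ord i.
have -> : m + i%:Z - m = i%:Z by lia.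
by have -> : n - (m + i%:Z) - k = (N - i)%N%:Z by lia.
Qed.

Lemma laurent_of1 : laurent_monomial 0 = laurent_of 0 1.
Proof. by apply/laurentP => n /=; rewrite subr0; case: n. Qed.

Fact laurent_mulA : associative laurent_mul.
Proof.
move=> f g h; have [m [A ->]] := laurent_ofP f.
have [[k [B ->]] [l [C ->]]] := (laurent_ofP g, laurent_ofP h).
by rewrite !laurent_ofM mulrA addrA.
Qed.

Fact laurent_mulC : commutative laurent_mul.
Proof.
move=> f g; have [[m [A ->]] [k [B ->]]] := (laurent_ofP f, laurent_ofP g).
by rewrite !laurent_ofM mulrC addrC.
Qed.

Fact laurent_mul1 : left_id (laurent_monomial 0) laurent_mul.
Proof.
move=> f; have [m [A ->]] := laurent_ofP f.
by rewrite laurent_of1 laurent_ofM mul1r add0r.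
Qed.

Fact laurent_mulDl : left_distributive laurent_mul +%R.
Proof.
move=> f g h; have [m [A [B [-> ->]]]] := laurent_ofP2 f g.
have [k [C ->]] := laurent_ofP h.
by rewrite laurent_ofD !laurent_ofM laurent_ofD mulrDl.
Qed.

Fact laurent_oner_neq0 : laurent_monomial 0 != 0.
Proof. by apply/eqP => /laurentP /(_ 0) /= /eqP; rewrite oner_eq0. Qed.

HB.instance Definition _ := GRing.Zmodule_isComNzRing.Build (laurent F)
  laurent_mulA laurent_mulC laurent_mul1 laurent_mulDl laurent_oner_neq0.

Lemma laurent_coefM f g n :
  (f * g) n = \sum_(i \in [set: int]) f i * g (n - i).
Proof. by []. Qed.

Definition laurent_inv f : laurent F := xget 0 [set g | g * f = 1].

Fact laurent_mulV f : f != 0 -> laurent_inv f * f = 1.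
Proof.
move=> f0; rewrite /laurent_inv; case: xgetP => [g _ //|nof]; exfalso.
have [m [A fE]] := laurent_ofP f.
have [k Ak Amin] : exists2 k, A k != 0 & forall i, (i < k)%N -> A i = 0.
  have exA : exists k, A k != 0.
    apply: contrapT => /forallNP A0; case/eqP: f0; rewrite fE.
    apply/laurentP => n /=; case: (n - m) => //= i.
    by apply/eqP/negPn/negP/A0.
  case: (ex_minnP exA) => k Ak kmin; exists k => // i ik.
  by apply/eqP; apply: contraLR ik => /kmin; rewrite -leqNgt.
pose B := Fps (fun i => A (i + k)%N).
have fE' : f = laurent_of (m + k%:Z) B.
  rewrite fE; apply/laurentP => n /=.
  case E : (n - (m + k%:Z)) => [i|i] /=.
    by have -> : n - m = (i + k)%N%:Z by lia.
  case E' : (n - m) => [j|j] //=; apply: Amin; lia.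
apply: (nof (laurent_of (- (m + k%:Z)) B^-1)).
rewrite /= fE' [LHS]laurent_ofM addNr mulVr ?fps_unitE ?unitfE//.
by rewrite -laurent_of1.
Qed.

Fact laurent_inv0 : laurent_inv 0 = 0.
Proof.
rewrite /laurent_inv; case: xgetP => // g _ /= /eqP.
by rewrite mulr0 eq_sym oner_eq0.
Qed.

HB.instance Definition _ :=
  GRing.ComNzRing_isField.Build (laurent F) laurent_mulV laurent_inv0.

Definition laurentX : laurent F := laurent_monomial 1.

(* The t-adic topology: the subgroups t^N F[[t]] are a base of neighborhoods  *)
(* of 0.                                                                      *)
Definition laurent_nbhs f : set_system (laurent F) :=
  filter_from [set: int]
    (fun N => [set g : laurent F | forall n, n < N -> g n = f n]).

HB.instance Definition _ := hasNbhs.Build (laurent F) laurent_nbhs.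

Fact laurent_nbhs_filter f : ProperFilter (nbhs f).
Proof.
apply: filter_from_proper => [|N _]; last by exists f.
apply: filter_from_filter => [|N M _ _]; first by exists 0.
exists (Num.max N M) => // g fg.
by split=> n nN; apply: fg; rewrite lt_max nN ?orbT.
Qed.

Fact laurent_nbhs_singleton f (S : set (laurent F)) : nbhs f S -> S f.
Proof. by case=> N _; apply. Qed.

Fact laurent_nbhs_nbhs f (S : set (laurent F)) : nbhs f S -> nbhs f (nbhs^~ S).
Proof.
case=> N _ NS; exists N => // g fg; exists N => // h gh.
by apply: NS => n nN; rewrite gh ?fg.
Qed.

HB.instance Definition _ := Nbhs_isNbhsTopological.Build (laurent F)
  laurent_nbhs_filter laurent_nbhs_singleton laurent_nbhs_nbhs.

End LaurentField.

Arguments laurentX {F}.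

(* The product is empty for j = 0, so that [gamma q 0] is 1.                  *)
Definition gamma (K : fieldType) (q : K) (j : nat) : K :=
  q ^+ 'C(j, 2) * \prod_(1 <= i < j.+1) (q ^+ i - 1).

Definition laurent_cvg_to (F : fieldType) (a : nat -> laurent F)
  (l : laurent F) : Prop := a @ \oo --> l.

(* The usual topology of the complex numbers is carried by [R[i]^o].          *)
Definition complex_cvg_to (R : realType) (a : nat -> R[i]) (l : R[i]) : Prop :=
  (a : nat -> R[i]^o) @ \oo --> (l : R[i]^o).

(* q is either an indeterminate, or a complex number of modulus > 1; [cvg_to] *)
(* is the corresponding convergence in the field K of coefficients. An        *)
(* indeterminate q is the inverse of the variable q^-1 of the Laurent series. *)
Inductive q_setting : forall K : fieldType,
    ((nat -> K) -> K -> Prop) -> K -> Prop :=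
| QIndeterminate : @q_setting (laurent rat) (@laurent_cvg_to rat) laurentX^-1
| QComplex (R : realType) (q : R[i]) :
    1 < `|q| -> @q_setting R[i] (@complex_cvg_to R) q.

(* Main.v *)
(* Write E(u) = \prod_(i >= 1) (1 + u q^-i), so that the left-hand side is    *)
(* E(u)^2 / E(-u^2), and A(u) for the right-hand side. The product formula    *)
(* gives E(qu) = (1 + u) E(u). The summands of A are                          *)
(* c_(r,s) = q^C(r+s,2) / (gamma_r gamma_s), r + s = n, and they satisfy      *)
(* (q^r - 1) c_(r,s) = q^s c_(r-1,s), and symmetrically; summing by parts     *)
(* yields (1 - u) (1 - q u^2) A(qu) = (1 + u) A(u). Hence E(u)^2 and          *)
(* A(u) E(-u^2) both solve F(qu) = (1 + u)^2 F(u), whose solutions are        *)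
(* determined by their constant coefficient since q^n <> 1 for n > 0.         *)
(* Both modes of convergence reduce to q^-N --> 0: by the q-binomial theorem, *)
(* each coefficient of the N-th partial products is a fixed polynomial in     *)
(* q^-N.                                                                      *)
Require Import Defs.
From HB Require Import structures.
From mathcomp Require Import all_boot all_order all_algebra.
From mathcomp Require Import zify ring.
From mathcomp Require Import complex.
From mathcomp Require Import boolp classical_sets reals.
From mathcomp Require Import topology normedtype sequences.

Set Implicit Arguments.
Unset Strict Implicit.
Unset Printing Implicit Defensive.

Import Order.TTheory GRing.Theory Num.Theory.
Import numFieldNormedType.Exports.
Local Open Scope ring_scope.

(** Let [euler] be the series with coefficients 1/((q-1)...(q^n-1)), which is E(u), and let A be
    [gamma_series]. The algebraic core is E(u)^2 = A(u) E(-u^2) ([euler_sqrE]): by [dilate_euler],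
    [dilate_euler_opp_sqr] and [dilate_gamma_series] both sides are multiplied by (1+u)^2 when u
    becomes qu, and [fps_dilate_unique] identifies them. The analytic part is that the partial
    products converge to E(u)^2 and E(-u^2). By [euler_prodE] their coefficients are polynomials in
    q^-N, so [cvg_horner_qV] handles both settings at once. *)

Section PowerSeries.
Variable K : fieldType.
Implicit Types (f g h : fps K) (a : K).

(** * Power series: the dilation u -> au and the substitution u -> -u^2 *)

Lemma fps_coefD f g n : (f + g) n = f n + g n.
Proof. by []. Qed.

Lemma fps_coefB f g n : (f - g) n = f n - g n.
Proof. by []. Qed.

Lemma fps_coefZ a f n : (a *: f) n = a * f n.
Proof. by []. Qed.

Lemma fps_coefM0 f g : (f * g) 0%N = f 0%N * g 0%N.
Proof. by rewrite fps_coefM big_ord1. Qed.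

Lemma fps_coefXM f n : (fpsX * f) n = if n is m.+1 then f m else 0.
Proof.
rewrite fps_coefM; case: n => [|n]; first by rewrite big_ord1 mul0r.
rewrite big_ord_recl big_ord_recl big1 => [|i _]; last by rewrite mul0r.
by rewrite mul0r add0r addr0 mul1r subSS subn0.
Qed.

Definition fps_dilate a f : fps K := Fps (fun n => a ^+ n * f n).

Lemma fps_dilateD a f g :
  fps_dilate a (f + g) = fps_dilate a f + fps_dilate a g.
Proof. by apply/fpsP => n /=; rewrite mulrDr. Qed.

Lemma fps_dilateB a f g :
  fps_dilate a (f - g) = fps_dilate a f - fps_dilate a g.
Proof. by apply/fpsP => n /=; rewrite mulrBr. Qed.

Lemma fps_dilateM a f g :
  fps_dilate a (f * g) = fps_dilate a f * fps_dilate a g.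
Proof.
apply/fpsP => n /=; rewrite mulr_sumr; apply: eq_bigr => i _.
by rewrite mulrACA -exprD subnKC // -ltnS.
Qed.

Lemma fps_dilateXM a f :
  fps_dilate a (fpsX * f) = a *: (fpsX * fps_dilate a f).
Proof.
apply/fpsP => n; rewrite fps_coefZ -[LHS]/(a ^+ n * _) !fps_coefXM.
by case: n => [|n]; rewrite ?mulr0 //= exprS mulrA.
Qed.

(** If the difference d vanishes below degree n > 0, comparing coefficients of degree n gives (a^n -
    1) d_n = 0. *)
Lemma fps_dilate_unique a f g h : (forall n, (0 < n)%N -> a ^+ n != 1) ->
    h 0%N = 1 -> f 0%N = g 0%N ->
  fps_dilate a f = h * f -> fps_dilate a g = h * g -> f = g.
Proof.
move=> a1 h0 fg0 ef eg; apply/eqP; rewrite -subr_eq0; apply/eqP.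
set d := f - g.
have ed : fps_dilate a d = h * d by rewrite fps_dilateB ef eg mulrBr.
apply/fpsP => n; elim/ltn_ind: n => -[|n] IH.
  by rewrite /d fps_coefB fg0 subrr.
have := congr1 (fun f : fps K => f n.+1) ed; rewrite [LHS]/= fps_coefM.
rewrite big_ord_recl h0 mul1r subn0 big1 => [|i _]; last first.
  by rewrite IH ?mulr0 //= /bump; lia.
move/eqP; rewrite addr0 -subr_eq0 -[X in _ - X]mul1r -mulrBl mulf_eq0 subr_eq0.
by rewrite (negbTE (a1 _ _)) //= => /eqP.
Qed.

(* The series f(-u^2).                                                        *)
Definition fps_comp_opp_sqr f : fps K :=
  Fps (fun n => if odd n then 0 else (-1) ^+ n./2 * f n./2).

Lemma fps_comp_opp_sqr_dilate a f :
  fps_dilate a (fps_comp_opp_sqr f)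
  = fps_comp_opp_sqr (fps_dilate a (fps_dilate a f)).
Proof.
apply/fpsP => n /=; case: ifP => on; first by rewrite mulr0.
rewrite -{1}(odd_double_half n) on add0n -addnn exprD.
ring.
Qed.

Lemma fps_comp_opp_sqrM a f :
  fps_comp_opp_sqr ((1 + a *: fpsX) * f)
  = (1 - a *: fpsX ^+ 2) * fps_comp_opp_sqr f.
Proof.
have coefl n : ((1 + a *: fpsX) * f) n
    = f n + a * (if n is m.+1 then f m else 0).
  by rewrite mulrDl mul1r -scalerAl fps_coefD fps_coefZ fps_coefXM.
apply/fpsP => n; rewrite mulrBl mul1r -scalerAl expr2 -mulrA.
rewrite fps_coefB fps_coefZ fps_coefXM.
have s0 g : fps_comp_opp_sqr g 0%N = g 0%N by rewrite /= expr0 mul1r.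
have s1 g : fps_comp_opp_sqr g 1%N = 0 by [].
have sSS g m : fps_comp_opp_sqr g m.+2
    = if odd m then 0 else (-1) ^+ m./2.+1 * g m./2.+1 by rewrite /= negbK.
have sE g m : fps_comp_opp_sqr g m
    = if odd m then 0 else (-1) ^+ m./2 * g m./2 by [].
case: n => [|[|n]]; rewrite ?fps_coefXM ?s0 ?s1 ?sSS ?(sE f n) ?coefl.
- by rewrite !mulr0 addr0 subr0.
- by rewrite mulr0 subr0.
by case: (odd n); rewrite ?mulr0 ?subrr // exprS; ring.
Qed.

End PowerSeries.

(** * Euler's series and its finite form, the q-binomial theorem *)

Section QSeries.
Context (K : fieldType) (q : K).
Hypotheses (q0 : q != 0) (q1 : forall n, (0 < n)%N -> q ^+ n != 1).

Let qB1 n : (0 < n)%N -> q ^+ n - 1 != 0.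
Proof. by move/q1; rewrite subr_eq0. Qed.

(* Euler's expansion of \prod_(i >= 1) (1 + u q^-i).                          *)
Definition euler : fps K :=
  Fps (fun n => (\prod_(1 <= i < n.+1) (q ^+ i - 1))^-1).

Lemma euler0 : euler 0%N = 1.
Proof. by rewrite /= big_geq // invr1. Qed.

Lemma eulerS n : (q ^+ n.+1 - 1) * euler n.+1 = euler n.
Proof. by rewrite /= big_nat_recr //= invfM mulrCA divff ?mulr1 ?qB1. Qed.

Lemma dilate_euler : fps_dilate q euler = (1 + fpsX) * euler.
Proof.
apply/fpsP => n; rewrite mulrDl mul1r fps_coefD fps_coefXM.
case: n => [|n]; first by rewrite addr0 /fps_dilate /= mul1r.
by rewrite -(eulerS n) -[LHS]/(q ^+ n.+1 * euler n.+1); ring.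
Qed.

(* For m < n both sides vanish, the factor j = m on the right being zero.     *)
Lemma euler_prodE m n :
  (\prod_(1 <= i < m.+1) (1 + q ^- i *: fpsX)) n
  = euler n * \prod_(j < n) (1 - q ^+ j * q ^- m) :> K.
Proof.
elim: m n => [|m IH] n.
  rewrite big_geq //; case: n => [|n]; first by rewrite euler0 big_ord0 mulr1.
  by rewrite big_ord_recl expr0 invr1 mul1r subrr mul0r mulr0.
have -> : \prod_(1 <= i < m.+2) (1 + q ^- i *: fpsX)
    = (1 + q ^- m.+1 *: fpsX) * \prod_(1 <= i < m.+1) (1 + q ^- i *: fpsX).
  by rewrite big_nat_recr //= mulrC.
rewrite mulrDl mul1r -scalerAl fps_coefD fps_coefZ.
rewrite fps_coefXM IH; case: n => [|n].
  by rewrite !big_ord0 mulr0 addr0.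
rewrite IH -(eulerS n); set w := q ^- m.+1.
have qw : q ^- m = q * w by rewrite /w exprS invfM mulVKf.
rewrite big_ord_recr big_ord_recl expr0 mul1r qw /=.
have e (j : nat) : 1 - q ^+ j.+1 * w = 1 - q ^+ j * (q * w).
  by rewrite exprSr mulrA.
rewrite [in RHS](eq_bigr (fun j : 'I_n => 1 - q ^+ j * (q * w))); last first.
  by move=> i _; rewrite /bump add1n e.
by rewrite exprS; ring.
Qed.

(** * The functional equation of the right-hand side *)

Let c r s : K := q ^+ 'C(r + s, 2) * (gamma q r * gamma q s)^-1.

Let gammaS r : gamma q r.+1 = q ^+ r * (q ^+ r.+1 - 1) * gamma q r.
Proof. by rewrite /gamma binS bin1 exprD big_nat_recr //=; ring. Qed.

Let gamma_neq0 r : gamma q r != 0.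
Proof.
elim: r => [|r IH]; first by rewrite /gamma big_geq // mulr1 expf_neq0.
rewrite gammaS; apply: mulf_neq0 IH; apply: mulf_neq0; last exact: qB1.
exact: expf_neq0.
Qed.

Let cSl r s : (q ^+ r.+1 - 1) * c r.+1 s = q ^+ s * c r s.
Proof.
rewrite /c gammaS addSn binS bin1 !exprD.
have := qB1 (ltn0Sn r); have := expf_neq0 r q0.
move: (gamma_neq0 r) (gamma_neq0 s); set x := q ^+ r.+1 - 1; move: x => x.
move: (gamma q r) (gamma q s) (q ^+ r) => y z w y0 z0 w0 x0.
by field; rewrite x0 y0 z0 w0.
Qed.

Let cC r s : c r s = c s r.
Proof. by rewrite /c addnC [gamma q r * _]mulrC. Qed.

Let cSr r s : (q ^+ s.+1 - 1) * c r s.+1 = q ^+ r * c r s.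
Proof. by rewrite cC cSl cC. Qed.

(* Since q^n = q^r q^s when r + s = n, linear combinations of the wsum        *)
(* weighted by monomials in q^r and q^s encode both A(u) and A(qu).           *)
Let wsum (g : nat -> nat -> K) : fps K :=
  Fps (fun n => \sum_(r < n.+1) g r (n - r)%N * c r (n - r)).

Let wsumD g h : wsum (fun r s => g r s + h r s) = wsum g + wsum h.
Proof.
apply/fpsP => n; rewrite fps_coefD /= -big_split.
by apply: eq_bigr => i _; rewrite /= mulrDl.
Qed.

Let wsumN g : wsum (fun r s => - g r s) = - wsum g.
Proof.
apply/fpsP => n /=; rewrite -sumrN.
by apply: eq_bigr => i _; rewrite mulNr.
Qed.

Let wsum_ext g h : (forall r s, g r s = h r s) -> wsum g = wsum h.
Proof. by move=> gh; apply/fpsP => n; apply: eq_bigr => i _; rewrite gh. Qed.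

(** The term r = 0 vanishes; in the others [cSl] trades q^r - 1 for q^s while lowering r, hence the
    degree, by one. *)
Let wsum_l g : wsum (fun r s => (q ^+ r - 1) * g r s)
  = fpsX * wsum (fun r s => q ^+ s * g r.+1 s).
Proof.
apply/fpsP => n; rewrite fps_coefXM /= big_ord_recl subrr !mul0r add0r.
case: n => [|n]; first by rewrite big_ord0.
apply: eq_bigr => i _; rewrite lift0 subSS.
by rewrite mulrAC cSl mulrAC.
Qed.

Let wsum_r g : wsum (fun r s => (q ^+ s - 1) * g r s)
  = fpsX * wsum (fun r s => q ^+ r * g r s.+1).
Proof.
apply/fpsP => n; rewrite fps_coefXM /= big_ord_recr /= subnn subrr !mul0r addr0.
case: n => [|n]; first by rewrite big_ord0.
apply: eq_bigr => i _; have -> : (n.+1 - i)%N = (n - i).+1.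
  by rewrite subSn // -ltnS.
by rewrite mulrAC cSr mulrAC.
Qed.

Definition gamma_series : fps K := Fps (fun n => q ^+ 'C(n, 2) *
  \sum_(0 <= r < n.+1) (gamma q r * gamma q (n - r))^-1).

Let wsum1 : wsum (fun _ _ => 1) = gamma_series.
Proof.
apply/fpsP => n; rewrite /= big_mkord mulr_sumr; apply: eq_bigr => i _.
by rewrite mul1r /c subnKC // -ltnS.
Qed.

Let wsumq : wsum (fun r s => q ^+ r * q ^+ s) = fps_dilate q gamma_series.
Proof.
rewrite -wsum1; apply/fpsP => n; rewrite /= mulr_sumr; apply: eq_bigr => i _.
by rewrite mul1r -exprD subnKC // -ltnS.
Qed.

Let wsumqS : wsum (fun r s => q ^+ s * q ^+ r.+1)
  = q *: fps_dilate q gamma_series.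
Proof.
rewrite -wsumq; apply/fpsP => n; rewrite fps_coefZ /= mulr_sumr.
by apply: eq_bigr => i _; rewrite exprS; ring.
Qed.

Lemma dilate_gamma_series :
  (1 - fpsX) * (1 - q *: fpsX ^+ 2) * fps_dilate q gamma_series
  = (1 + fpsX) * gamma_series.
Proof.
set A := gamma_series; set B := fps_dilate q A.
(* The auxiliary sums enter only through T + Q2 and Q2 - Q, which [h2] and [h3] express by A and
   B. *)
pose T := wsum (fun r s => q ^+ s); pose Q := wsum (fun r s => q ^+ r).
pose Q2 := wsum (fun r s => q ^+ r * q ^+ r).
have h1 : B - A = fpsX * (T + Q2).
  transitivity (wsum (fun r s => (q ^+ r - 1) * 1 + (q ^+ s - 1) * q ^+ r)).
    rewrite -[A]wsum1 -[B]wsumq -wsumN -wsumD.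
    by apply: wsum_ext => r s; ring.
  rewrite wsumD wsum_l wsum_r -mulrDr; congr (_ * (_ + _)).
  by apply: wsum_ext => r s; rewrite mulr1.
have h3 : Q2 - Q = fpsX * (q *: B).
  rewrite -wsumqS -(wsum_l (fun r s => q ^+ r)) -wsumN -wsumD.
  by apply: wsum_ext => r s; ring.
have h2 : T + Q2 - B - A = fpsX * (q *: B) - fpsX * (Q2 - Q).
  rewrite mulrBr -h3 -(wsum_r (fun r s => q ^+ r)).
  have -> : fpsX * Q = wsum (fun r s => (q ^+ s - 1) * 1).
    by rewrite wsum_r; congr (_ * _); apply: wsum_ext => r s; rewrite mulr1.
  rewrite -[A]wsum1 -[B]wsumq -!wsumN -!wsumD -!wsumN -!wsumD.
  by apply: wsum_ext => r s; ring.
have e : B - A = fpsX * (B + A + fpsX * (q *: B) - fpsX * (fpsX * (q *: B))).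
  rewrite h1; congr (_ * _).
  by rewrite -[X in _ - fpsX * X]h3 -addrA -h2; ring.
rewrite -mulrA [(1 - q *: _) * _]mulrBl mul1r -scalerAl scalerAr.
transitivity (B - (B - A) + fpsX * A); last by ring.
by rewrite e; ring.
Qed.

Lemma dilate_euler_opp_sqr :
  fps_dilate q (fps_comp_opp_sqr euler)
  = (1 - q *: fpsX ^+ 2) * (1 - fpsX ^+ 2) * fps_comp_opp_sqr euler.
Proof.
have -> : fps_dilate q (fps_comp_opp_sqr euler)
    = fps_comp_opp_sqr ((1 + q *: fpsX) * ((1 + 1 *: fpsX) * euler)).
  rewrite fps_comp_opp_sqr_dilate dilate_euler mulrDl mul1r.
  rewrite fps_dilateD fps_dilateXM dilate_euler scalerAl scale1r.
  by congr fps_comp_opp_sqr; ring.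
by rewrite !fps_comp_opp_sqrM scale1r mulrA.
Qed.

Lemma euler_sqrE : euler ^+ 2 = gamma_series * fps_comp_opp_sqr euler.
Proof.
have Ug : (1 - fpsX : fps K) \is a GRing.unit.
  by rewrite fps_unitE fps_coefB /= subr0 unitr1.
apply: (@fps_dilate_unique _ q _ _ ((1 + fpsX) ^+ 2)) => //.
- by rewrite expr2 fps_coefM0 /= addr0 mul1r.
- have g0 : gamma_series 0%N = 1.
    rewrite /= big_nat1 /gamma big_geq // subnn bin_small // expr0.
    by rewrite !mulr1 invr1 mulr1.
  have s0 : fps_comp_opp_sqr euler 0%N = 1.
    by rewrite /= big_geq // invr1 expr0 mul1r.
  by rewrite expr2 !fps_coefM0 euler0 g0 s0.
- by rewrite expr2 fps_dilateM dilate_euler; ring.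
(* The equation for A(qu) carries a factor 1 - u, so both sides are multiplied by this unit; 1 - u^2
   = (1-u)(1+u) supplies it on the other side. *)
apply: (mulrI Ug); rewrite fps_dilateM dilate_euler_opp_sqr.
transitivity ((1 - fpsX) * (1 - q *: fpsX ^+ 2) * fps_dilate q gamma_series
    * ((1 - fpsX ^+ 2) * fps_comp_opp_sqr euler)); first by ring.
by rewrite dilate_gamma_series; ring.
Qed.

(** * Convergence of the partial products, for an abstract mode of convergence *)

Variable cvg_to : (nat -> K) -> K -> Prop.
Hypotheses (cvg_cst : forall a, cvg_to (fun=> a) a)
  (cvgD : forall a b l m, cvg_to a l -> cvg_to b m ->
    cvg_to (fun N => a N + b N) (l + m))
  (cvgMqV : forall a l, cvg_to a l -> cvg_to (fun N => a N * q ^- N) 0).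

Lemma cvg_horner_qV (p : {poly K}) : cvg_to (fun N => p.[q ^- N]) p.[0].
Proof.
elim/poly_ind: p => [|p a IH].
  rewrite horner0; have -> : (fun N => (0 : {poly K}).[q ^- N]) = fun=> 0.
    by apply/funext => N; rewrite horner0.
  exact: cvg_cst.
rewrite hornerMXaddC mulr0.
have -> : (fun N => (p * 'X + a%:P).[q ^- N])
    = fun N => p.[q ^- N] * q ^- N + a.
  by apply/funext => N; rewrite hornerMXaddC.
by apply: cvgD (cvg_cst a); apply: cvgMqV IH.
Qed.

(** Its value at q^-N is the coefficient of degree n of the N-th partial product of E; its value at
    0 is the limit. *)
Let euler_poly n : {poly K} := (euler n)%:P * \prod_(j < n) (1 - q ^+ j *: 'X).

Let euler_polyE n a :
  (euler_poly n).[a] = euler n * \prod_(j < n) (1 - q ^+ j * a).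
Proof.
rewrite hornerM hornerC horner_prod; congr (_ * _); apply: eq_bigr => j _.
by rewrite hornerD hornerN hornerZ hornerX hornerC.
Qed.

Let euler_poly0 n : (euler_poly n).[0] = euler n.
Proof.
by rewrite euler_polyE big1 ?mulr1 // => j _; rewrite mulr0 subr0.
Qed.

Lemma is_fps_prod_euler_sqr :
  is_fps_prod cvg_to (fun i => (1 + q ^- i *: fpsX) ^+ 2) (euler ^+ 2).
Proof.
move=> n; pose p := \sum_(i < n.+1) euler_poly i * euler_poly (n - i).
have -> : (euler ^+ 2) n = p.[0].
  rewrite horner_sum expr2 fps_coefM; apply: eq_bigr => i _.
  by rewrite hornerM !euler_poly0.
have -> : (fun N => (\prod_(1 <= i < N.+1) (1 + q ^- i *: fpsX) ^+ 2) n)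
    = fun N => p.[q ^- N].
  apply/funext => N; rewrite prodrXl expr2 fps_coefM horner_sum.
  by apply: eq_bigr => i _; rewrite hornerM !euler_polyE !euler_prodE.
exact: cvg_horner_qV.
Qed.

Lemma is_fps_prod_euler_opp_sqr :
  is_fps_prod cvg_to (fun i => 1 - q ^- i *: fpsX ^+ 2)
    (fps_comp_opp_sqr euler).
Proof.
have prodE N : \prod_(1 <= i < N.+1) (1 - q ^- i *: fpsX ^+ 2)
    = fps_comp_opp_sqr (\prod_(1 <= i < N.+1) (1 + q ^- i *: fpsX)).
  elim: N => [|N IH].
    rewrite !big_geq //; apply/fpsP => -[|[|n]] //=; rewrite ?expr0 ?mul1r //.
    by rewrite mulr0 if_same.
  rewrite big_nat_recr //= IH mulrC -fps_comp_opp_sqrM mulrC.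
  by rewrite [in RHS]big_nat_recr.
move=> n; pose p := if odd n then 0 else (-1) ^+ n./2 *: euler_poly n./2.
have -> : fps_comp_opp_sqr euler n = p.[0].
  rewrite /p -[LHS]/(if odd n then _ else _).
  by case: (odd n); rewrite ?horner0 // hornerZ euler_poly0.
have -> : (fun N => (\prod_(1 <= i < N.+1) (1 - q ^- i *: fpsX ^+ 2)) n)
    = fun N => p.[q ^- N].
  apply/funext => N; rewrite prodE /p -[LHS]/(if odd n then _ else _).
  by case: (odd n); rewrite ?horner0 // hornerZ euler_polyE euler_prodE.
exact: cvg_horner_qV.
Qed.

Lemma euler_product_quotient : exists N D : fps K,
  [/\ is_fps_prod cvg_to (fun i => (1 + q ^- i *: fpsX) ^+ 2) N,
      is_fps_prod cvg_to (fun i => 1 - q ^- i *: fpsX ^+ 2) D,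
      D \is a GRing.unit & N / D = gamma_series].
Proof.
have UD : fps_comp_opp_sqr euler \is a GRing.unit.
  by rewrite fps_unitE /= big_geq // invr1 expr0 mul1r unitr1.
exists (euler ^+ 2), (fps_comp_opp_sqr euler); split => //.
- exact: is_fps_prod_euler_sqr.
- exact: is_fps_prod_euler_opp_sqr.
by rewrite euler_sqrE mulrK.
Qed.

End QSeries.

(** * Indeterminate q: the t-adic topology, with t = q^-1 *)

Section Laurent.
Variable F : fieldType.
Implicit Types f l : laurent F.
Local Open Scope classical_set_scope.
Local Open Scope ring_scope.

Lemma laurent_coefM_monomial f (k n : int) :
  (f * laurent_monomial F k) n = f (n - k).
Proof.
have [m [A ->]] := laurent_ofP f.
have -> : laurent_monomial F k = laurent_of k 1.
  apply/laurentP => i /=; rewrite -subr_eq0.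
  by case: (i - k) => [[|j]|j].
have -> : laurent_of m A * laurent_of k 1 = laurent_of (m + k) A.
  by rewrite [LHS]laurent_ofM mulr1.
by rewrite /= opprD addrA addrAC.
Qed.

Lemma laurentXn n : (laurentX : laurent F) ^+ n = laurent_monomial F n.
Proof.
elim: n => [|n IH]; first by [].
rewrite exprSr IH; apply/laurentP => i; rewrite laurent_coefM_monomial /=.
by congr (_ %:R); congr nat_of_bool; lia.
Qed.

Lemma laurentXV_neq0 : (laurentX^-1 : laurent F) != 0.
Proof.
rewrite invr_eq0; apply/eqP => /laurentP /(_ 1) /= /eqP.
by rewrite oner_eq0.
Qed.

Lemma laurentXV_expn_neq1 n : (0 < n)%N -> (laurentX^-1 : laurent F) ^+ n != 1.
Proof.
move=> n0; rewrite exprVn invr_eq1 laurentXn; apply/eqP => /laurentP /(_ 0) /=.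
have -> : (0 == n%:Z) = false by lia.
by move/esym/eqP; rewrite oner_eq0.
Qed.

Lemma laurent_cvg_toP (a : nat -> laurent F) l : laurent_cvg_to a l <->
  forall M : int, \forall N \near \oo, forall n, n < M -> a N n = l n.
Proof.
split=> [al M|al S [M _ MS]].
  by apply: (al [set g : laurent F | forall n, n < M -> g n = l n]); exists M.
by apply: filterS (al M) => N; apply: MS.
Qed.

Lemma laurent_cvg_toD (a b : nat -> laurent F) l m :
  laurent_cvg_to a l -> laurent_cvg_to b m ->
  laurent_cvg_to (fun N => a N + b N) (l + m).
Proof.
move=> /laurent_cvg_toP al /laurent_cvg_toP bm; apply/laurent_cvg_toP => M.
apply: filterS2 (al M) (bm M) => N aN bN n nM.
by rewrite /= aN ?bN.
Qed.

Lemma laurent_cvg_to0 (a : nat -> laurent F) l :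
  laurent_cvg_to a l -> laurent_cvg_to (fun N => a N * laurentX^-1 ^- N) 0.
Proof.
move=> /laurent_cvg_toP al; apply/laurent_cvg_toP => M.
have [m lm] := laurent_bounded l.
have large : \forall N \near \oo, (`|M - m| <= N)%N by exists `|M - m|%N.
(* Agreement with l below its order bound m makes a N vanish there, eventually in N; multiplying by
   t^N with N >= M - m then clears all degrees below M. *)
apply: filterS2 (al m) large => N aN mN n nM.
rewrite exprVn invrK laurentXn laurent_coefM_monomial aN ?lm //; lia.
Qed.

End Laurent.

(** * Complex q: reduction to a real geometric sequence *)

Section Complex.
Variable R : realType.
Implicit Types (q l : R[i]).
Local Open Scope classical_set_scope.
Local Open Scope ring_scope.

Lemma complex_expnV_cvg0 q : 1 < `|q| -> complex_cvg_to (fun N => q ^- N) 0.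
Proof.
move=> q1; have [r qr] : exists r, `|q| = r%:C%C.
  by apply/complex_realP; exact: normr_real.
have r1 : 1 < r by rewrite -ltcR -qr.
have r0 : 0 < r := lt_trans ltr01 r1.
have rN0 : (fun N => r^-1 ^+ N) @ \oo --> (0 : R).
  by apply: cvg_expr; rewrite normfV gtr0_norm // invf_lt1.
apply/cvgr0Pnorm_lt => e e0.
have [d ed] : exists d, e = d%:C%C by apply/complex_realP; exact: gtr0_real.
have d0 : 0 < d by rewrite -ltcR -ed.
apply: filterS ((cvgr0Pnorm_lt _).1 rN0 d d0) => N rNd.
rewrite normfV normrX qr ed -rmorphXn -fmorphV ltcR.
by move: rNd; rewrite ger0_norm ?exprVn // invr_ge0 exprn_ge0 // ltW.
Qed.

End Complex.

(* [fpsX] is the variable u. *)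
Theorem corollary3p7 (K : fieldType) (cvg_to : (nat -> K) -> K -> Prop) (q : K)
    (hq : q_setting cvg_to q) :
  exists N D : fps K,
    [/\ is_fps_prod cvg_to (fun i => (1 + q ^- i *: fpsX) ^+ 2) N,
        is_fps_prod cvg_to (fun i => 1 - q ^- i *: fpsX ^+ 2) D,
        D \is a GRing.unit
      & N / D = Fps (fun n => q ^+ 'C(n, 2) *
                  \sum_(0 <= r < n.+1) (gamma q r * gamma q (n - r))^-1)].
Proof.
case: hq => [|R {}q q1].
  apply: euler_product_quotient.
  - exact: laurentXV_neq0.
  - exact: laurentXV_expn_neq1.
  - by move=> a; apply: cvg_cst.
  - exact: laurent_cvg_toD.
  - exact: laurent_cvg_to0.
apply: euler_product_quotient.
- by rewrite -normr_gt0 (lt_trans ltr01).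
- move=> n n0; apply/eqP => /(congr1 Num.norm); rewrite normrX normr1.
  by apply/eqP; rewrite gt_eqF // exprn_egt1 // -lt0n.
- by move=> a; apply: cvg_cst.
- by move=> a b l m; apply: cvgD.
move=> a l al; rewrite -(mulr0 l).
by apply: cvgM al _; apply: complex_expnV_cvg0.
Qed.
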